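(* For $w\in S_n$, the following are equivalent: (i) $w$ is $1432$-avoiding; (ii) $\mathsf{SKKoh}(w)=\mathsf{KKoh}(w)$.
   Context: Cells of $[n]\times[n]$ are indexed in matrix notation: $(i,j)$ is row $i$ (from the top), column $j$ (from the left). A permutation $w$ is $1432$-avoiding if there are no indices $j_1<j_2<j_3<j_4$ with $w(j_1)<w(j_4)<w(j_3)<w(j_2)$. The Rothe diagram of $w\in S_n$ is $D(w)=\{(i,j)\in[n]^2: i<w^{-1}(j),\ j<w(i)\}$. A grave diagram is a pair $E=(B,G)$ of disjoint subsets of $[n]\times[n]$; cells of $B$ are boxes, cells of $G$ are ghosts, cells of $B\cup G$ are occupied. Suppose $(i,j)\in B$ is rightmost among all occupied cells in row $i$; let $i'=\max\{r: 1\leq r<i,\ (r,j)\notin B\cup G\}$; assume $i'$ exists and every occupied cell $(r,j)$ with $i'<r\leq i$ is a box. The ordinary Kohnert move at row $i$ is $(B,G)\mapsto((B\setminus\{(i,j)\})\cup\{(i',j)\},G)$; the $K$-Kohnert move at row $i$ is $(B,G)\mapsto((B\setminus\{(i,j)\})\cup\{(i',j)\},G\cup\{(i,j)\})$. Such a move is simple if it shifts the box upward by exactly one row, i.e. $i'=i-1$. $\mathsf{KKoh}(w)$ is the closure of $(D(w),\varnothing)$ under ordinary and $K$-Kohnert moves; $\mathsf{SKKoh}(w)$ is the closure of $(D(w),\varnothing)$ under simple ordinary and simple $K$-Kohnert moves. *)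

(* Defs.v *)
From HB Require Import structures.
From mathcomp Require Import all_boot all_fingroup.
Set Implicit Arguments.
Unset Strict Implicit.
Unset Printing Implicit Defensive.

(* Matrix coordinates, zero-based: (i, j) is row i from the top and column j
   from the left, so that moving up means decreasing the row index. *)
Notation cell n := ('I_n * 'I_n)%type.

Definition avoids1432 n (w : 'S_n) : Prop :=
  ~ (exists j1 j2 j3 j4 : 'I_n,
       [/\ j1 < j2, j2 < j3 & j3 < j4] /\
       [/\ w j1 < w j4, w j4 < w j3 & w j3 < w j2]).

Definition rothe n (w : 'S_n) : {set cell n} :=
  [set c : cell n | (c.1 < (w^-1)%g c.2) && (c.2 < w c.1)].

Record grave n := Grave {
  gpair : {set cell n} * {set cell n};
  gdisj : [disjoint gpair.1 & gpair.2]
}.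

HB.instance Definition _ n := [isSub for @gpair n].
HB.instance Definition _ n := [Countable of grave n by <:].
HB.instance Definition _ n := [Finite of grave n by <:].

Section Moves.
Variable n : nat.
Implicit Types (E F : grave n) (i j r : 'I_n).

Definition boxes E : {set cell n} := (gpair E).1.
Definition ghosts E : {set cell n} := (gpair E).2.
Definition occupied E : {set cell n} := boxes E :|: ghosts E.

Definition rightmost_box E i j : bool :=
  ((i, j) \in boxes E) &&
  [forall c : 'I_n, ((i, c) \in occupied E) ==> (c <= j)].

(* r = max {s | s < i, (s, j) unoccupied}; false for every r when this set
   is empty. *)
Definition landing_row E i j r : bool :=
  [&& r < i, (r, j) \notin occupied E &
   [forall s : 'I_n, (s < i) && ((s, j) \notin occupied E) ==> (s <= r)]].

Definition movable E i j r : bool :=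
  [&& rightmost_box E i j, landing_row E i j r &
   [forall s : 'I_n,
      [&& r < s, s <= i & (s, j) \in occupied E] ==> ((s, j) \in boxes E)]].

Definition moved_boxes E i j r : {set cell n} :=
  (boxes E :\ (i, j)) :|: [set (r, j)].

Definition ordinary_result E i j r F : bool :=
  (boxes F == moved_boxes E i j r) && (ghosts F == ghosts E).

Definition K_result E i j r F : bool :=
  (boxes F == moved_boxes E i j r) && (ghosts F == ghosts E :|: [set (i, j)]).

Definition KKoh_move : rel (grave n) := fun E F =>
  [exists i : 'I_n, exists j : 'I_n, exists r : 'I_n,
     movable E i j r && (ordinary_result E i j r F || K_result E i j r F)].

Definition simple_KKoh_move : rel (grave n) := fun E F =>
  [exists i : 'I_n, exists j : 'I_n, exists r : 'I_n,
     [&& r.+1 == i :> nat, movable E i j r &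
      ordinary_result E i j r F || K_result E i j r F]].

End Moves.

Fact rothe_disj n (w : 'S_n) :
  [disjoint (rothe w, set0 : {set cell n}).1
          & (rothe w, set0 : {set cell n}).2].
Proof. by rewrite disjoint_sym disjoints_subset sub0set. Qed.

Definition rothe_grave n (w : 'S_n) : grave n := Grave (rothe_disj w).

Definition KKoh n (w : 'S_n) : {set grave n} :=
  [set E | connect (@KKoh_move n) (rothe_grave w) E].

Definition SKKoh n (w : 'S_n) : {set grave n} :=
  [set E | connect (@simple_KKoh_move n) (rothe_grave w) E].

(* Main.v *)
(* Label the boxes of each column by the row of the Rothe diagram they started
   in, reading a jump over a run of boxes as pushing the whole run up by one.
   Simple moves preserve the following invariant: for j < k, the box of row x
   in column j stays weakly below the box of row x in column k and all of its
   ghosts.  When w avoids 1432, whenever (y, j), (y, k), (x, j) are in D(w) with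
   y < x and j < k but (x, k) is not, column j is full down to row y and hence
   frozen there; this makes the invariant stable under all moves.  It also lets
   any diagram satisfying the invariant be built by simple moves, treating the
   boxes of D(w) row by row from the top and from right to left in each row
   (below, the last such box is pulled back down one row at a time).
   Conversely, in a 1432 pattern at positions e < a < b < c with b - a minimal
   and then w(c) maximal, the box (b, w(c)) can climb to row a + 1 and jump over
   (a, w(c)), although (a, w(b)) has not moved: this breaks the invariant. *)

Require Import Defs.
From mathcomp Require Import all_boot all_fingroup.
From mathcomp Require Import zify.

Set Implicit Arguments.
Unset Strict Implicit.
Unset Printing Implicit Defensive.

Section Tracking.
Variables (n : nat) (w : 'S_n).
Implicit Types (E F : grave n) (d : cell n) (u m : cell n -> 'I_n).
Implicit Types i j k l r s t x y z : 'I_n.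

(** * Rothe diagrams of 1432-avoiding permutations *)

Lemma mem_rothe x j : ((x, j) \in rothe w) = (x < (w^-1)%g j) && (j < w x).
Proof. by rewrite inE. Qed.

(** If [(z, j)] were missing, then [w z < j], because [j] occurs further down. Positions [z] and [y]
    would start a 1432 pattern ending at the position of [j]; its third position is that of [k] if
    [k < w x], and [x] otherwise. *)
Lemma avoids1432_column_filled y x j k :
  avoids1432 w -> (y, j) \in rothe w -> (y, k) \in rothe w ->
  (x, j) \in rothe w -> (x, k) \notin rothe w -> y < x -> j < k ->
  forall z, z <= y -> (z, j) \in rothe w.
Proof.
move=> avw; rewrite !mem_rothe => /andP[yj jy] /andP[yk ky] /andP[xj jx] xk lyx ljk z lzy.
rewrite mem_rothe; apply/andP; split; first by lia.
rewrite ltnNge; apply/negP => lzj; apply: avw.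
have wjK : w ((w^-1)%g j) = j by rewrite permKV.
have wkK : w ((w^-1)%g k) = k by rewrite permKV.
have nwz : w z <> j.
  by move=> wzj; move: yj; rewrite -wzj permK; lia.
have nwz' : w z <> j :> nat by move=> /val_inj.
have lzy' : z < y.
  rewrite ltn_neqAle lzy andbT; apply/eqP => /val_inj zy; move: lzj; rewrite zy; lia.
case: (ltnP k (w x)) => wxk.
  exists z, y, ((w^-1)%g k), ((w^-1)%g j); rewrite wjK wkK.
  split; split; lia.
exists z, y, x, ((w^-1)%g j); rewrite wjK.
split; split; lia.
Qed.

(* [u (x, j)] is the current row of the box of column [j] that started in row
   [x], and [m (x, j)] the lowest row held by this box or one of its ghosts. *)
Record tracked E u m : Prop := Tracked {
  tracked_um : forall d, d \in rothe w -> u d <= m d;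
  tracked_m_row : forall d, d \in rothe w -> m d <= d.1;
  tracked_column : forall x y j, (x, j) \in rothe w -> (y, j) \in rothe w ->
    x < y -> m (x, j) < u (y, j);
  tracked_row : forall x j k, (x, j) \in rothe w -> (x, k) \in rothe w ->
    j < k -> m (x, k) <= u (x, j);
  tracked_u_box : forall d, d \in rothe w -> (u d, d.2) \in boxes E;
  tracked_box : forall s j, (s, j) \in boxes E ->
    exists2 x : 'I_n, (x, j) \in rothe w & u (x, j) = s;
  tracked_ghost : forall s j, (s, j) \in ghosts E ->
    exists2 x : 'I_n, (x, j) \in rothe w & u (x, j) < s <= m (x, j);
  tracked_m_occ : forall d, d \in rothe w -> (m d, d.2) \in occupied E
}.

(* [lia] is very slow on the set memberships and local definitions of this
   development, so it is run on the arithmetic part of the context only. *)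
Ltac arith := repeat match goal with
  | H := _ |- _ => clearbody H
  | H : is_true (_ \in _) |- _ => clear H
  | H : is_true (_ \notin _) |- _ => clear H
  | H : is_true (ordinary_result _ _ _ _ _ || _) |- _ => clear H
  | H : ?P |- _ => match type of P with Prop =>
      match P with
      | forall _, _ => clear H
      | is_true (movable _ _ _ _) => clear H
      | avoids1432 _ => clear H
      | _ = _ :> {set _} => clear H
      | tracked _ _ _ => clear H
      | _ \/ avoids1432 _ => clear H
      end end
  end; lia.

Lemma grave_eq E F : boxes E = boxes F -> ghosts E = ghosts F -> E = F.
Proof.
move=> eB eG; apply: val_inj => /=.
by move: eB eG; rewrite /boxes /ghosts; case: (gpair E) (gpair F) => ? ? [? ?] /= -> ->.
Qed.

Lemma tracked_rothe : tracked (rothe_grave w) fst fst.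
Proof.
split=> //=.
- by case.
- by move=> s j; exists s.
- by move=> s j; rewrite /ghosts /= inE.
- by move=> [x j] xj; rewrite /occupied inE; apply/orP; left.
Qed.

(** * Consequences of the invariant *)

Section Facts.
Variables (E : grave n) (u m : cell n -> 'I_n).
Hypothesis T : tracked E u m.

Lemma tracked_u_row d : d \in rothe w -> u d <= d.1.
Proof. by move=> dD; apply: leq_trans (tracked_um T dD) (tracked_m_row T dD). Qed.

Lemma tracked_u_mono x y j : (x, j) \in rothe w -> (y, j) \in rothe w ->
  x < y -> u (x, j) < u (y, j).
Proof.
move=> xD yD lxy; have := tracked_column T xD yD lxy; have := tracked_um T xD; arith.
Qed.

Lemma tracked_occ s j : (s, j) \in occupied E ->
  exists2 x : 'I_n, (x, j) \in rothe w & u (x, j) <= s <= m (x, j).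
Proof.
rewrite inE => /orP[/(tracked_box T)|/(tracked_ghost T)] [x xD xs]; exists x => //.
  by rewrite -xs leqnn (tracked_um T xD).
arith.
Qed.

Lemma tracked_label_uniq s j x y : (x, j) \in rothe w -> (y, j) \in rothe w ->
  u (x, j) <= s <= m (x, j) -> u (y, j) <= s <= m (y, j) -> x = y.
Proof.
move=> xD yD xs ys; apply: val_inj; case: (ltngtP x y) => // lxy.
  have := tracked_column T xD yD lxy; arith.
have := tracked_column T yD xD lxy; arith.
Qed.

Lemma tracked_m_box x j : (x, j) \in rothe w -> (m (x, j), j) \in boxes E ->
  u (x, j) = m (x, j).
Proof.
move=> xD /(tracked_box T)[y yD ym].
rewrite -{1}(@tracked_label_uniq (m (x, j)) j y x) // ?leqnn ?andbT.
  by rewrite -ym leqnn (tracked_um T yD).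
exact: (tracked_um T xD).
Qed.

(** Along rows 0 to [y], [u] is strictly increasing, hence at least the identity; it is at most the
    identity because boxes never sink. *)
Lemma tracked_filled_fixed y j : (forall z, z <= y -> (z, j) \in rothe w) ->
  u (y, j) = y.
Proof.
move=> fill; suff H c z : z <= y -> z = c :> nat -> z <= u (z, j).
  apply/val_inj/eqP; rewrite eqn_leq; have /= -> := tracked_u_row (fill y (leqnn y)).
  exact: (H y).
elim: c z => [|c IH] z lzy zk; first by rewrite zk.
have kn : c < n by have := ltn_ord z; arith.
have lky : Ordinal kn <= y by rewrite /=; arith.
have := IH (Ordinal kn) lky erefl.
have lkz : Ordinal kn < z by rewrite /=; arith.
have := tracked_u_mono (fill _ lky) (fill _ lzy) lkz.
move=> /=; arith.
Qed.

(** Keeps the right of a pulled-back box clear of labels from higher rows. If [(x, k)] is in the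
    diagram, column [k] and row [x] give the bound; otherwise column [j] is frozen down to row [y],
    so [m (y, k) <= y < u (x, j)]. *)
Lemma tracked_upper_right x y j k : avoids1432 w ->
  (x, j) \in rothe w -> (y, k) \in rothe w -> y < x -> j < k ->
  m (y, k) < u (x, j).
Proof.
move=> avw xj yk lyx ljk.
have yj : (y, j) \in rothe w by move: xj yk; rewrite !mem_rothe; arith.
case: (boolP ((x, k) \in rothe w)) => xk.
  have := tracked_column T yk xk lyx; have := tracked_row T xj xk ljk; have := tracked_um T xk; arith.
have /tracked_filled_fixed uy := avoids1432_column_filled avw yj yk xj xk lyx ljk.
have := tracked_u_mono yj xj lyx; have := tracked_m_row T yk; rewrite uy /=; arith.
Qed.

End Facts.

(** * Preservation of the invariant under moves *)

Definition up_row z : 'I_n := Ordinal (leq_ltn_trans (leq_pred z) (ltn_ord z)).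

Section Step.
Variables (E F : grave n) (u m : cell n -> 'I_n) (i j r : 'I_n).
Hypothesis T : tracked E u m.
Hypothesis mov : movable E i j r.
Hypothesis simple_or_avoids : r.+1 = i \/ avoids1432 w.
Hypothesis res : ordinary_result E i j r F || K_result E i j r F.

(** [keep] singles out the K-move. Each box of the run rises by one row, never from row 0 since the
    run is below [r]. If it has no ghosts, [m] rises with it, unless it leaves a new ghost in row
    [i]. *)
Let keep := (i, j) \in ghosts F.
Let pushed d := (d.2 == j) && (r < u d <= i).
Let u' d := if pushed d then up_row (u d) else u d.
Let m' d := if [&& pushed d, m d == u d & ~~ (keep && (u d == i))]
            then up_row (u d) else m d.

Let ri : r < i.
Proof. by case/and3P: mov => _ /and3P[]. Qed.

Let r_free : (r, j) \notin occupied E.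
Proof. by case/and3P: mov => _ /and3P[]. Qed.

Let ij_box : (i, j) \in boxes E.
Proof. by case/and3P: mov => /andP[]. Qed.

Let run_box s : r < s <= i -> (s, j) \in boxes E.
Proof.
case/and3P: mov => _ /and3P[_ _ /forallP max] /forallP run /andP[lrs lsi].
apply: (implyP (run s)); rewrite lrs lsi /=; apply: contraT => sfree.
case: (ltngtP s i) lsi => // [lsi _|si _].
  by have := implyP (max s); rewrite lsi sfree => /(_ isT); arith.
by move: sfree; rewrite inE (val_inj si) ij_box.
Qed.

Let right_free k : j < k -> (i, k) \notin occupied E.
Proof.
case/and3P: mov => /andP[_ /forallP right] _ _ ljk.
by apply/negP => occ; have := implyP (right k) occ; arith.
Qed.

Let boxesF : boxes F = moved_boxes E i j r.
Proof. by case/orP: res => /andP[/eqP ->]. Qed.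

Let ghostsF s k : ((s, k) \in ghosts F) = ((s, k) \in ghosts E) || (keep && ((s, k) == (i, j))).
Proof.
rewrite /keep; have ijg : (i, j) \notin ghosts E.
  apply/negP => ijg; have := gdisj E; rewrite disjoint_sym => /pred0P/(_ (i, j)) /=.
  by move: ij_box ijg; rewrite /boxes /ghosts => -> ->.
case/orP: res => /andP[_ /eqP ->]; first by rewrite (negPf ijg) orbF.
by rewrite !inE eqxx orbT.
Qed.

Let u'_le d : u' d <= u d.
Proof. by rewrite /u'; case: ifP => //= _; exact: leq_pred. Qed.

Let m'_le d : d \in rothe w -> m' d <= m d.
Proof.
move=> dD; rewrite /m'; case: ifP => //= _; have := tracked_um T dD.
by apply: leq_trans; exact: leq_pred.
Qed.

(** Induction up the run from row [i], where nothing lies to the right; a simple move has no other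
    row. Otherwise let [y] label the next box down. If [(y, k)] is in the diagram, contact at [x]
    contradicts the bound for [y]; if not, column [j] is frozen down to row [x], so [r] would be
    occupied. *)
Let no_contact x k : (x, j) \in rothe w -> (x, k) \in rothe w -> j < k ->
  r < u (x, j) <= i -> m (x, k) < u (x, j).
Proof.
move=> xj xk ljk.
have [c] := ubnP (i - u (x, j)); elim: c x xj xk => // c IH x xj xk lc run.
have /= le := tracked_row T xj xk ljk.
rewrite ltn_neqAle le andbT; apply/eqP => eq.
have ne : u (x, j) <> i :> nat.
  move=> /val_inj ui; have := tracked_m_occ T xk.
  by rewrite (val_inj eq) ui /= (negPf (right_free ljk)).
case: simple_or_avoids => [|avw]; first by arith.
have ltn : (u (x, j)).+1 < n by have := ltn_ord i; arith.
have /run_box/(tracked_box T)[y yj uy] : r < Ordinal ltn <= i by rewrite /=; arith.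
have uy' : u (y, j) = (u (x, j)).+1 :> nat by rewrite uy.
have lxy : x < y.
  case: (ltngtP x y) => // [lyx|/val_inj xy].
    by have := tracked_u_mono T yj xj lyx; arith.
  by move: uy'; rewrite xy; arith.
have yk : (y, k) \in rothe w.
  apply: contraT => yk.
  have fill := avoids1432_column_filled avw xj xk yj yk lxy ljk.
  have ux := tracked_filled_fixed T fill.
  have lrx : r <= x by case/andP: run; rewrite ux => /ltnW.
  case/negP: r_free; rewrite inE; apply/orP; left.
  rewrite -(@tracked_filled_fixed _ _ _ T r j); first exact: (tracked_u_box T (fill r lrx)).
  by move=> z lzr; apply: fill; arith.
have := tracked_column T xk yk lxy; have := tracked_um T yk.
have := IH y yj yk; rewrite uy'; arith.
Qed.

Let u'_box d : d \in rothe w -> (u' d, d.2) \in boxes F.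
Proof.
case: d => x k dD; rewrite boxesF /moved_boxes !inE /u' /pushed /= !xpair_eqE.
have /= ub := tracked_u_box T dD.
case: (eqVneq k j) => [kj|nkj] /=; last by rewrite ub andbF.
subst k; case: ifPn => [run|nrun].
  rewrite !andbT; have [//|nr] := eqVneq (up_row (u (x, j))) r.
    by rewrite orbT.
  rewrite orbF; apply/andP; split.
    by apply/eqP => /(congr1 val) /=; arith.
  apply: run_box; move/eqP: nr => nr.
  have : (u (x, j)).-1 <> r by move=> e; apply: nr; apply: val_inj.
  move=> /=; arith.
rewrite !andbT ub andbT.
by case: (eqVneq (u (x, j)) i) nrun => // ->; rewrite ri leqnn.
Qed.

Lemma tracked_step : exists u1 m1, tracked F u1 m1.
Proof.
exists u', m'; split.
- move=> d dD; have um := tracked_um T dD; rewrite /m'.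
  case: ifPn => [/and3P[pd _ _]|_]; first by rewrite /u' pd.
  exact: leq_trans (u'_le d) um.
- by move=> d dD; apply: leq_trans (m'_le dD) (tracked_m_row T dD).
- move=> x y k xD yD lxy.
  have lt := tracked_column T xD yD lxy; have m'm := m'_le xD.
  rewrite /u'; case: ifP => [|_]; last by arith.
  rewrite /pushed /= => /andP[/eqP kj run]; subst k.
  (* The danger is that [y] is pushed onto row [m (x, j)]. That row is then in the run, so [x] has
     no ghosts there and is pushed too. *)
  case: (ltnP (m (x, j)) (u (y, j)).-1) => [|ge]; first by arith.
  have mx : m (x, j) = (u (y, j)).-1 :> nat by arith.
  have /= occ := tracked_m_occ T xD.
  have mr : m (x, j) <> r by move=> e; move: r_free; rewrite -e occ.
  have mr' : m (x, j) <> r :> nat by move=> /val_inj.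
  have mb : (m (x, j), j) \in boxes E by apply: run_box; arith.
  have um := tracked_m_box T xD mb.
  rewrite /m' /pushed /= um !eqxx /=.
  have -> /= : r < m (x, j) <= i by arith.
  have -> /= : (m (x, j) == i) = false.
    by apply/eqP => /(congr1 val) /=; arith.
  rewrite andbF /=; arith.
- move=> x k l xk xl lkl.
  have le := tracked_row T xk xl lkl; have m'm := m'_le xl.
  rewrite /u'; case: ifP => [|_]; last by arith.
  rewrite /pushed /= => /andP[/eqP kj run]; subst k.
  have := no_contact xk xl lkl run; arith.
- exact: u'_box.
- move=> s k; rewrite boxesF /moved_boxes !inE !xpair_eqE.
  case: (eqVneq k j) => [->|nkj]; last first.
    rewrite !andbF orbF /= => /(tracked_box T)[x xD us]; exists x => //.
    by rewrite /u' /pushed /= (negPf nkj).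
  rewrite !andbT => H.
  (* [c] is the row from which the box now in row [s] came. *)
  have [c] : exists c : 'I_n, c = (if (r <= s) && (s < i) then s.+1 else s) :> nat.
    case: ifP => [/andP[_ lsi]|_]; last by exists s.
    by exists (Ordinal (leq_ltn_trans lsi (ltn_ord i))).
  move=> cE.
  have /(tracked_box T)[x xD ux] : (c, j) \in boxes E.
    move: cE; case: ifPn => [lrs cE|lrs /val_inj ->]; first by apply: run_box; arith.
    case/orP: H => [/andP[_ //]|/eqP sr].
    by move: lrs; rewrite sr leqnn ri.
  exists x => //; rewrite /u' /pushed /= eqxx /= ux.
  have si : s <> i.
    by case/orP: H => [/andP[/eqP]|/eqP ->] //; move=> e; move: ri; rewrite e ltnn.
  have si' : s <> i :> nat by move=> /val_inj.
  apply: val_inj; move: cE.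
  by case: ifPn => A; case: ifPn => B /=; arith.
- move=> s k; rewrite ghostsF => /orP[/(tracked_ghost T)[x xD us]|].
    exists x => //; rewrite (leq_ltn_trans (u'_le _)) /=; last by arith.
    rewrite /m'; case: ifP => [/and3P[_ /eqP e _]|_]; last by arith.
    by move: us; rewrite e; arith.
  move=> /andP[kp /eqP[-> ->]].
  have [x xD ui] := tracked_box T ij_box; exists x => //.
  rewrite /u' /m' /pushed /= eqxx ui ri leqnn kp eqxx andbF /=.
  have := tracked_um T xD; rewrite ui; arith.
- move=> d dD; rewrite inE /m'; case: ifPn => [/and3P[pd _ _]|].
    by have := u'_box dD; rewrite /u' pd => ->.
  case: d dD => x k dD /=; have /= := tracked_m_occ T dD.
  rewrite inE ghostsF boxesF /moved_boxes !inE xpair_eqE.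
  case/orP => [mb|->]; last by rewrite orbT.
  rewrite mb andbT; case: (eqVneq k j) => [kj|nkj]; last by rewrite andbF.
  subst k; rewrite !andbT; case: (eqVneq (m (x, j)) i) => [mi|//].
  (* This label is that of the moved box itself, and [m'] stayed at [i] only because of its new
     ghost. *)
  have um := tracked_m_box T dD mb.
  rewrite /pushed /= um mi !eqxx ri leqnn /= andbT negbK => ->.
  by rewrite !orbT.
Qed.

End Step.

(** * Undoing a simple move *)

(* [(x, j)] is the displaced box that comes last in the order "row from the top,
   then column from the right", so a simple move into the present state can be
   the one that lifted it from row [v]. *)
Section Undo.
Variables (E : grave n) (u m : cell n -> 'I_n) (x j v : 'I_n).
Hypothesis T : tracked E u m.
Hypothesis avw : avoids1432 w.
Hypothesis xj : (x, j) \in rothe w.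
Hypothesis vE : v = (u (x, j)).+1 :> nat.
Hypothesis vx : v <= x.
Hypothesis lower_fixed : forall y k, (y, k) \in rothe w -> x < y -> u (y, k) = y.
Hypothesis left_fixed : forall k, (x, k) \in rothe w -> k < j -> u (x, k) = x.

(** A ghost at [(v, j)] means that the undone move was a K-move, so it disappears under the box. The
    value of [m] changes only if the box had no ghosts. *)
Let B := (boxes E :\ (u (x, j), j)) :|: [set (v, j)].
Let G := ghosts E :\ (v, j).

Let disjBG : [disjoint (B, G).1 & (B, G).2].
Proof.
apply/pred0P => -[s k] /=; rewrite !inE.
have /pred0P/(_ (s, k)) /= := gdisj E; rewrite -/(boxes E) -/(ghosts E).
by case: ((s, k) \in boxes E); case: ((s, k) \in ghosts E);
  case: ((s, k) == (v, j)); rewrite ?andbF ?orbF.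
Qed.

Let E0 : grave n := Grave disjBG.
Let u0 d := if d == (x, j) then v else u d.
Let m0 d := if d == (x, j) then (if v <= m d then m d else v) else m d.

Let v_nbox : (v, j) \notin boxes E.
Proof.
apply/negP => /(tracked_box T)[y yj uy].
case: (ltngtP x y) => [lxy|lyx|/val_inj xy].
- by move: uy; rewrite (lower_fixed yj lxy) => yv; move: lxy; rewrite yv; arith.
- by have := tracked_u_mono T yj xj lyx; rewrite uy; arith.
- by move: vE; rewrite xy uy; arith.
Qed.

Let E0_tracked : tracked E0 u0 m0.
Proof.
have um := tracked_um T xj; have /= mx := tracked_m_row T xj.
split.
- move=> d dD; rewrite /u0 /m0; case: ifP => _; last exact: (tracked_um T dD).
  by case: ifP => //; rewrite leqnn.
- move=> d dD; rewrite /m0; case: eqP => [->|_]; last exact: (tracked_m_row T dD).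
  by case: ifP.
- move=> y z k yk zk lyz; rewrite /u0 /m0 !xpair_eqE.
  have lt := tracked_column T yk zk lyz.
  case: (eqVneq k j) => [kj|_]; last by rewrite !andbF.
  subst k; rewrite !andbT; case: (eqVneq y x) => [yx|_].
    subst y; rewrite (lower_fixed zk lyz).
    have -> : (z == x) = false by apply/eqP => zx; move: lyz; rewrite zx ltnn.
    by case: ifP => _; arith.
  by case: (eqVneq z x) => [zx|//]; subst z; arith.
- move=> y k l yk yl lkl; rewrite /u0 /m0 !xpair_eqE.
  have le := tracked_row T yk yl lkl.
  case: (eqVneq y x) => [yx|//]; subst y => /=.
  have [lj|_] := eqVneq l j.
    subst l; have -> : (k == j) = false by apply/eqP => kj; move: lkl; rewrite kj ltnn.
    by rewrite (left_fixed yk lkl); case: ifP.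
  by have [kj|//] := eqVneq k j; subst k; arith.
- move=> [y k] yk; rewrite /u0; case: eqP => [[-> ->]|nyx].
    by rewrite /boxes /= /B !inE eqxx orbT.
  rewrite /boxes /= /B !inE !xpair_eqE (tracked_u_box T yk) andbT.
  have [kj|nkj] := eqVneq k j; last by rewrite !andbF.
  subst k; rewrite !andbT; have [e|//] := eqVneq (u (y, j)) (u (x, j)).
  case: nyx; congr pair; apply: (@tracked_label_uniq _ _ _ T (u (x, j)) j) => //.
    by rewrite e leqnn -e (tracked_um T yk).
  by rewrite leqnn (tracked_um T xj).
- move=> s k; rewrite /boxes /= /B !inE /u0.
  case/orP => [/andP[ne /(tracked_box T)[y yk us]]|/eqP[-> ->]].
    exists y => //; case: eqP => // -[yx kj]; subst y k.
    by move: ne; rewrite us eqxx.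
  by exists x => //; rewrite eqxx.
- move=> s k; rewrite /ghosts /= /G !inE /u0 /m0.
  case/andP => ne /(tracked_ghost T)[y yk us].
  exists y => //; case: eqP => // -[yx kj]; subst y k.
  have ne' : s <> v :> nat by move=> /val_inj sv; move: ne; rewrite sv eqxx.
  case: ifP; arith.
- move=> [y k] yk; rewrite /occupied /boxes /ghosts /= /B /G !inE /m0 !xpair_eqE.
  have /= occ := tracked_m_occ T yk.
  have [kj|nkj] := eqVneq k j; last first.
    by move: occ; rewrite !andbF orbF /= !inE.
  subst k; rewrite !andbT; have [yx|nyx] := eqVneq y x.
    subst y; case: leqP => [lvm|_]; last by rewrite eqxx orbT.
    have -> : (m (x, j) == u (x, j)) = false.
      by apply/eqP => /(congr1 val) /=; arith.
    by move: occ; rewrite inE; case: (m (x, j) == v); rewrite ?orbT ?orbF.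
  have [e|ne] := eqVneq (m (y, j)) (u (x, j)).
    case/eqP: nyx; apply: (@tracked_label_uniq _ _ _ T (u (x, j)) j) => //.
      by rewrite -e leqnn andbT (tracked_um T yk).
    by rewrite leqnn (tracked_um T xj).
  move: occ; rewrite inE /=; case: (m (y, j) == v); by rewrite ?orbT ?orbF.
Qed.

Lemma tracked_undo : exists E1 : grave n,
  simple_KKoh_move E1 E /\ tracked E1 u0 m0.
Proof.
exists E0; split; last exact: E0_tracked.
apply/existsP; exists v; apply/existsP; exists j; apply/existsP; exists (u (x, j)).
have ubox := tracked_u_box T xj.
have bE : boxes E = moved_boxes E0 v j (u (x, j)).
  apply/setP => -[s k]; rewrite /moved_boxes /boxes /= -/(boxes E) /B !inE.
  have [[-> ->]|ne] := eqVneq (s, k) (u (x, j), j); first by rewrite orbT.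
  have [[-> ->]|ne'] := eqVneq (s, k) (v, j); first by rewrite (negPf v_nbox).
  by rewrite !orbF.
apply/and3P; split; first by rewrite vE.
- apply/and3P; split.
  + apply/andP; split; first by rewrite /boxes /= /B !inE eqxx orbT.
    (* Labels from rows below [x] are fixed, hence below [v]; those from row [x] or above reach at
       most row [u (x, j)]. *)
    apply/forallP => k; apply/implyP => /(tracked_occ E0_tracked)[y yk].
    rewrite /u0 /m0 => occ; rewrite leqNgt; apply/negP => ljk; move: occ.
    have -> : ((y, k) == (x, j)) = false.
      by apply/eqP => -[_ kj]; move: ljk; rewrite kj ltnn.
    case: (ltngtP x y) => [lxy|lyx|/val_inj xy].
    * by rewrite (lower_fixed yk lxy); arith.
    * by have := tracked_upper_right T avw xj yk lyx ljk; arith.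
    * by subst y; have := tracked_row T xj yk ljk; arith.
  + apply/and3P; split; first by rewrite vE.
      apply/negP => /(tracked_occ E0_tracked)[y yj]; rewrite /u0 /m0 xpair_eqE eqxx andbT.
      case: eqP => [_|nyx]; first by arith.
      case: (ltngtP x y) => [lxy|lyx|/val_inj xy].
      * by rewrite (lower_fixed yj lxy); arith.
      * by have := tracked_column T yj xj lyx; arith.
      * by case: nyx.
    by apply/forallP => s; apply/implyP => /andP[lsv _]; arith.
  + apply/forallP => s; apply/implyP => /and3P[lus lsv _].
    have -> : s = v by apply: val_inj => /=; arith.
    by rewrite /boxes /= /B !inE eqxx orbT.
- have [vg|vg] := boolP ((v, j) \in ghosts E).
    apply/orP; right; apply/andP; split; first exact/eqP.
    by apply/eqP; rewrite setUC; symmetry; apply: setD1K.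
  apply/orP; left; apply/andP; split; first exact/eqP.
  apply/eqP/setP => -[s k]; rewrite [RHS]inE [X in _ && X]/= !inE.
  by have [[-> ->]|//] := eqVneq (s, k) (v, j); rewrite ?(negPf vg).
Qed.

End Undo.

(** * Reachability and the invariant *)

Lemma tracked_SKKoh E u m : avoids1432 w -> tracked E u m -> E \in SKKoh w.
Proof.
move=> avw; rewrite inE.
have [c] := ubnP (\sum_(d in rothe w) (d.1 - u d)).
elim: c E u m => // c IH E u m lc T.
(* Since [n - d.2] lies between 1 and [n], rows are compared first and ties favour the left column.
   The induction is on the total displacement. *)
pose late d := d.1 * n + (n - d.2).
pose P d := (d \in rothe w) && (u d < d.1).
(* Without displaced boxes, [u < s <= m] leaves no room for ghosts, so only the initial diagram
   remains. *)
have [d0 Pd0|none] := pickP P; last first.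
  have fixed d : d \in rothe w -> u d = d.1.
    move=> dD; have := none d; rewrite /P dD /= => /negbT; rewrite -leqNgt => ge.
    by apply/val_inj/eqP; rewrite /= eqn_leq (tracked_u_row T dD).
  suff -> : E = rothe_grave w by exact: connect0.
  apply: grave_eq; apply/setP => -[s k]; rewrite /= ?inE.
    apply/idP/idP => [/(tracked_box T)[x xk <-]|sk].
      by rewrite (fixed _ xk) /= -mem_rothe.
    have skD : (s, k) \in rothe w by rewrite mem_rothe.
    by have := tracked_u_box T skD; rewrite (fixed _ skD).
  apply/negP => /(tracked_ghost T)[x xk]; rewrite (fixed _ xk) /=.
  have := tracked_m_row T xk; move=> /=; arith.
have [x [j [/andP[xj /= lux] max]]] : exists x j, P (x, j) /\
    forall d, P d -> late d <= late (x, j).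
  by case: (arg_maxnP late Pd0) => -[x j] Pxj max; exists x, j.
have vn : (u (x, j)).+1 < n by have := ltn_ord x; arith.
have lower y k : (y, k) \in rothe w -> x < y -> u (y, k) = y.
  move=> yk lxy; have := max (y, k); rewrite /P /late yk /= => H.
  apply/val_inj/eqP; rewrite /= eqn_leq; have /= -> /= := tracked_u_row T yk.
  rewrite leqNgt; apply/negP => /H; have := ltn_ord k; have := ltn_ord j; nia.
have left k : (x, k) \in rothe w -> k < j -> u (x, k) = x.
  move=> xk lkj; have := max (x, k); rewrite /P /late xk /= => H.
  apply/val_inj/eqP; rewrite /= eqn_leq; have /= -> /= := tracked_u_row T xk.
  rewrite leqNgt; apply/negP => /H; have := ltn_ord k; have := ltn_ord j; arith.
have [E1 [step T1]] := @tracked_undo E u m x j (Ordinal vn) T avw xj erefl lux lower left.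
apply: connect_trans (connect1 step); apply: IH T1.
move: lc; rewrite (bigD1 (x, j)) //= [X in X < c](bigD1 (x, j)) //= eqxx /=.
rewrite [X in _ -> _ + X < _](eq_bigr (fun d => d.1 - u d)) => [|d /andP[_ /negPf ->]] //.
arith.
Qed.

Lemma simple_move_KKoh_move E F : simple_KKoh_move E F -> KKoh_move E F.
Proof.
case/existsP => i /existsP[j /existsP[r /and3P[_ mov res]]].
by apply/existsP; exists i; apply/existsP; exists j; apply/existsP; exists r; rewrite mov.
Qed.

Lemma SKKoh_sub_KKoh : SKKoh w \subset KKoh w.
Proof.
apply/subsetP => E; rewrite !inE; apply: connect_sub => F1 F2 step.
exact/connect1/simple_move_KKoh_move.
Qed.

(** Used for simple moves with any [w], and for all moves when [w] avoids 1432. *)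
Lemma connect_tracked (e : rel (grave n)) E :
  (forall E1 E2 u m, e E1 E2 -> tracked E1 u m -> exists u1 m1, tracked E2 u1 m1) ->
  connect e (rothe_grave w) E -> exists u m, tracked E u m.
Proof.
move=> step /connectP[p].
have : exists u m, tracked (rothe_grave w) u m by exists fst, fst; exact: tracked_rothe.
elim: p (rothe_grave w) => [|E2 p IH] E1 T /=; first by move=> _ ->.
case/andP => st; apply: IH; case: T => u [m T]; exact: step st T.
Qed.

Lemma SKKoh_tracked E : E \in SKKoh w -> exists u m, tracked E u m.
Proof.
rewrite inE; apply: connect_tracked => E1 E2 u m.
case/existsP => i /existsP[j /existsP[r /and3P[/eqP ri mov res]]] T.
by apply: (tracked_step T mov _ res); left.
Qed.

Lemma KKoh_tracked E : avoids1432 w -> E \in KKoh w -> exists u m, tracked E u m.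
Proof.
move=> avw; rewrite inE; apply: connect_tracked => E1 E2 u m.
case/existsP => i /existsP[j /existsP[r /andP[mov res]]] T.
by apply: (tracked_step T mov _ res); right.
Qed.

(** * A 1432 pattern breaks the invariant *)

Definition pattern1432 (t : 'I_n * 'I_n * 'I_n * 'I_n) : bool :=
  let: (e, a, b, c) := t in
  [&& e < a, a < b, b < c, w e < w c, w c < w b & w b < w a].

Fact box_grave_disj (B : {set cell n}) :
  [disjoint (B, set0 : {set cell n}).1 & (B, set0 : {set cell n}).2].
Proof. by rewrite disjoint_sym disjoints_subset sub0set. Qed.

(** Ordinary moves suffice for the counterexample, so no ghosts occur. *)
Definition box_grave B : grave n := Grave (box_grave_disj B).

Section Jump.
Variables e a b c : 'I_n.
Hypothesis pat : pattern1432 (e, a, b, c).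
Hypothesis narrow : forall e1 a1 b1 c1 : 'I_n, pattern1432 (e1, a1, b1, c1) -> b - a <= b1 - a1.
Hypothesis last_high : forall c1 : 'I_n, pattern1432 (e, a, b, c1) -> w c1 <= w c.

Let j := w c.
Let k := w b.
(** The stages of the climb, starting from [S b], the Rothe diagram itself. *)
Let S s : {set cell n} := (rothe w :\ (b, j)) :|: [set (s, j)].

(** A cell there gives [w s > w c], so [s] could replace [a] or [b] in the pattern, making it
    narrower. *)
Let between s l : a < s < b -> j <= l -> (s, l) \notin rothe w.
Proof.
move=> sab jl; rewrite mem_rothe; apply/negP => /andP[_ lws].
have nsb : w s <> w b :> nat by move=> /val_inj/perm_inj sb; move: sab; rewrite sb; lia.
have := @narrow e s b c; have := @narrow e a s c; move: pat; rewrite /pattern1432.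
rewrite /j in jl; lia.
Qed.

(** The position of [l] could replace [c], against the maximality of [w c]. *)
Let right_of_b l : j < l -> (b, l) \notin rothe w.
Proof.
move=> jl; rewrite mem_rothe; apply/negP => /andP[bl lwb].
have := @last_high ((w^-1)%g l); move: pat; rewrite /pattern1432 permKV.
rewrite /j in jl; lia.
Qed.

Let bj : (b, j) \in rothe w.
Proof. by move: pat; rewrite /pattern1432 mem_rothe permK /j; lia. Qed.

Let aj : (a, j) \in rothe w.
Proof. by move: pat; rewrite /pattern1432 mem_rothe permK /j; lia. Qed.

Let ak : (a, k) \in rothe w.
Proof. by move: pat; rewrite /pattern1432 mem_rothe permK /k; lia. Qed.

Let ej : (e, j) \notin rothe w.
Proof. by move: pat; rewrite /pattern1432 mem_rothe permK /j; lia. Qed.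

Let mem_S s x l : ((x, l) \in S s) =
  ((x, l) != (b, j)) && ((x, l) \in rothe w) || ((x, l) == (s, j)).
Proof. by rewrite /S !inE. Qed.

(** Covers both the one-row climbs and the final jump over row [a]. The box is rightmost by
    [right_of_b] in row [b] and by [between] higher up. *)
Let jump_move s r : a < s <= b -> r < s -> (r, j) \notin S s ->
  (forall t, r < t < s -> (t, j) \in S s) ->
  KKoh_move (box_grave (S s)) (box_grave (S r)).
Proof.
move=> sab lrs rfree run.
apply/existsP; exists s; apply/existsP; exists j; apply/existsP; exists r.
have occS : occupied (box_grave (S s)) = S s by rewrite /occupied /boxes /ghosts /= setU0.
have sj : (s, j) \notin rothe w :\ (b, j).
  have [->|sb] := eqVneq s b; first by rewrite !inE eqxx.
  rewrite in_setD1 negb_and between ?orbT //.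
  have : s <> b :> nat by move=> /val_inj/eqP; rewrite (negPf sb).
  lia.
apply/andP; split.
  apply/and3P; split; rewrite ?occS.
  - apply/andP; split; first by rewrite /boxes /= mem_S eqxx orbT.
    apply/forallP => l; apply/implyP; rewrite occS mem_S => H.
    rewrite leqNgt; apply/negP => jl; move: H.
    have -> : ((s, l) == (s, j)) = false.
      by apply/eqP => -[lj]; move: jl; rewrite lj ltnn.
    rewrite orbF => /andP[_]; apply/negP.
    have [->|sb] := eqVneq s b; first exact: right_of_b.
    apply: between; last exact: ltnW.
    have : s <> b :> nat by move=> /val_inj/eqP; rewrite (negPf sb).
    lia.
  - apply/and3P; split; rewrite ?occS //.
    apply/forallP => t; apply/implyP => /andP[lts tfree]; rewrite leqNgt.
    by apply/negP => lrt; case/negP: tfree; apply: run; rewrite lrt.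
  - by apply/forallP => t; apply/implyP => /and3P[].
apply/orP; left; apply/andP; split; last by rewrite /ghosts.
apply/eqP/setP => -[t l]; rewrite /moved_boxes /boxes /=.
rewrite /S !inE; have [[-> ->]|] := eqVneq (t, l) (s, j); last by rewrite orbF.
by move: sj; rewrite !inE => /negPf ->.
Qed.

Let descend s : a < s <= b -> box_grave (S s) \in KKoh w.
Proof.
have [d] := ubnP (b - s); elim: d s => // d IH s ld sab; rewrite inE.
have [->|sb] := eqVneq s b.
  suff -> : box_grave (S b) = rothe_grave w by exact: connect0.
  by apply: grave_eq; rewrite // /boxes /= /S setUC setD1K.
have nsb : s <> b :> nat by move=> /val_inj/eqP; rewrite (negPf sb).
have s1n : s.+1 < n by have := ltn_ord b; lia.
have sab1 : a < Ordinal s1n <= b by rewrite /=; lia.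
have := IH (Ordinal s1n) _ sab1; rewrite inE /= => /(_ ltac:(lia)) conn.
apply: connect_trans conn (connect1 _); apply: jump_move => //=.
- rewrite mem_S negb_or negb_and between ?orbT //=; last by lia.
  by rewrite xpair_eqE andbC /= eqxx /=; apply/eqP => /(congr1 val) /=; lia.
- by move=> t; lia.
Qed.

(** Column [k] is unchanged, hence frozen, and row [a] then forces [u (a, j) = a]. So column [j] has
    one more box above row [a] than labels available for it. *)
Let untracked r u m : r < a -> (r, j) \notin rothe w -> ~ tracked (box_grave (S r)) u m.
Proof.
move=> lra rj T.
have lab : a < b by case/and5P: pat.
have jk : j < k by case/and5P: pat => _ _ _ _ /andP[].
have fixk (d : nat) x : x < d -> (x, k) \in rothe w -> u (x, k) = x.
  elim: d x => // d IH x lxd xk.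
  have := tracked_u_box T xk; rewrite /boxes /= mem_S !xpair_eqE.
  have -> : (k == j) = false by apply/eqP => kj; move: jk; rewrite kj ltnn.
  rewrite !andbF orbF /= => uk; have /= le := tracked_u_row T xk.
  apply: val_inj; case: (ltngtP (u (x, k)) x) => //= lt; last by move: le; rewrite leqNgt lt.
  have uu := IH (u (x, k)) (leq_trans lt lxd) uk.
  by have := tracked_u_mono T uk xk lt; rewrite uu ltnn.
have ua : u (a, j) = a.
  apply/val_inj/eqP; rewrite /= eqn_leq; have /= -> /= := tracked_u_row T aj.
  have := tracked_row T aj ak jk; have := tracked_um T ak.
  by rewrite (fixk a.+1) //; exact: leq_trans.
(* The box still in row [x] needs a label [y] strictly between [x] and [a], again displaced, and so
   on without end. *)
have stuck (d : nat) x : a - x < d -> (x, j) \in rothe w -> x < a -> u (x, j) < x -> False.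
  elim: d x => // d IH x ld xj xa ux.
  have xS : (x, j) \in boxes (box_grave (S r)).
    rewrite /boxes /= mem_S xj andbT xpair_eqE eqxx andbT.
    by have -> : x != b by apply/eqP => xb; move: xa; rewrite xb; lia.
  have [y yj uy] := tracked_box T xS.
  have lxy : x < y.
    case: (ltngtP x y) => // [lyx|/val_inj xy].
      by have := tracked_u_mono T yj xj lyx; rewrite uy ltnNge (ltnW ux).
    by move: ux; rewrite xy uy xy ltnn.
  have lya : y < a.
    case: (ltngtP y a) => // [lay|/val_inj ya].
      by have := tracked_u_mono T aj yj lay; rewrite uy ua; arith.
    by move: uy; rewrite ya ua => ax; move: xa; rewrite ax ltnn.
  by apply: (IH y) => //; [arith | rewrite uy].
have rS : (r, j) \in boxes (box_grave (S r)) by rewrite /boxes /= mem_S eqxx orbT.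
have [x xj ux] := tracked_box T rS.
have /= lux := tracked_u_row T xj.
have lxa : x < a.
  case: (ltngtP x a) => // [lax|/val_inj xa].
    by have := tracked_u_mono T aj xj lax; rewrite ux ua; arith.
  by move: ux; rewrite xa ua => ar; move: lra; rewrite ar ltnn.
apply: (stuck (a - x).+1 x) => //; rewrite ltn_neqAle lux andbT.
by apply/eqP => /val_inj e1; move: rj; rewrite -ux e1 xj.
Qed.

Lemma jump_untracked : exists2 E, E \in KKoh w & forall u m, ~ tracked E u m.
Proof.
have [lea lab _ _ _] : [/\ e < a, a < b, b < c, w e < w c & w c < w b].
  by move: pat; rewrite /pattern1432 => /and5P[-> -> -> -> /andP[-> _]].
have a1n : a.+1 < n by have := ltn_ord b; lia.
pose s := Ordinal a1n.
have sab : a < s <= b by rewrite /s /=; lia.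
(* The jump lands in the lowest such row; [e] is one because [w e < w c]. *)
pose free t := (t <= a) && ((t, j) \notin rothe w).
have free_e : free e by rewrite /free ej andbT ltnW.
case: (arg_maxnP (@nat_of_ord n) free_e) => r /andP[lra rj] max.
have {}lra : r < a.
  rewrite ltn_neqAle lra andbT; apply/eqP => /val_inj ra.
  by move: rj; rewrite ra aj.
exists (box_grave (S r)); last by move=> u m; exact: untracked.
have := descend sab; rewrite !inE => conn.
apply: connect_trans conn (connect1 _); apply: jump_move => //.
- by rewrite /s /=; lia.
- rewrite mem_S negb_or negb_and rj orbT /= xpair_eqE eqxx andbT.
  by apply/eqP => /(congr1 val) /=; lia.
move=> t /= rts; rewrite mem_S xpair_eqE eqxx andbT.
have -> /= : t != b by apply/eqP => tb; move: rts; rewrite tb; lia.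
apply/orP; left; apply: contraT => tj.
by have := max t; rewrite /free tj andbT; lia.
Qed.

End Jump.

Lemma pattern_untracked : ~ avoids1432 w ->
  exists2 E, E \in KKoh w & forall u m, ~ tracked E u m.
Proof.
(* Minimizing [key] makes [b - a] minimal first and then [w c] maximal, as [n - w c] lies between 1
   and [n]. *)
move=> navw; pose key (t : 'I_n * 'I_n * 'I_n * 'I_n) :=
  let: (e, a, b, c) := t in (b - a) * n + (n - w c).
have [t0 pt0|none] := pickP pattern1432; last first.
  case: navw => -[e [a [b [c [[? ? ?] [? ? ?]]]]]].
  by have /negP[] := negbT (none (e, a, b, c)); apply/and5P; split=> //; apply/andP.
case: (arg_minnP key pt0) => -[[[e a] b] c] pat min.
apply: (@jump_untracked e a b c pat) => [e1 a1 b1 c1|c1] pat1.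
  have := min (e1, a1, b1, c1) pat1; rewrite /key => le; rewrite leqNgt; apply/negP => lt.
  have := ltn_ord (w c1); have := ltn_ord (w c); nia.
have := min (e, a, b, c1) pat1; rewrite /key.
have := ltn_ord (w c1); have := ltn_ord (w c); lia.
Qed.

End Tracking.

Theorem theorem5p7 (n : nat) (w : 'S_n) :
  avoids1432 w <-> SKKoh w = KKoh w.
Proof.
split=> [avw|eqK pat].
  apply/eqP; rewrite eqEsubset SKKoh_sub_KKoh /=; apply/subsetP => E.
  by case/(KKoh_tracked avw) => u [m T]; exact: tracked_SKKoh T.
have [|E EK] := @pattern_untracked n w; first by apply.
by move: EK; rewrite -eqK => /SKKoh_tracked[u [m T]] /(_ u m).
Qed.
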